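(* Any non-trivial 2-dimensional real evolution algebra is isomorphic to one and only one of the following evolution algebras, listed by their matrices of structure constants (different parameter values count as different members of the list, except that $E_{1,r}(b,c)$ and $E_{1,r}(c,b)$ are isomorphic and count as the same member): \[E_{1,r}(b,c)=\begin{pmatrix}1&0&0&b\\ c&0&0&1\end{pmatrix}\simeq E_{1,r}(c,b),\quad (b,c)\in\mathbb{R}^2,\ bc\ne1,\] \[E_{2,r}(b)=\begin{pmatrix}1&0&0&b\\ 1&0&0&0\end{pmatrix},\ b\in\mathbb{R},\quad E_{3,r}=\begin{pmatrix}0&0&0&1\\ 1&0&0&0\end{pmatrix},\quad E_{4,r}=\begin{pmatrix}1&0&0&1\\ 0&0&0&0\end{pmatrix},\] \[E_{5,r}=\begin{pmatrix}1&0&0&-1\\ 0&0&0&0\end{pmatrix},\quad E_{6,r}=\begin{pmatrix}1&0&0&-1\\ -1&0&0&1\end{pmatrix},\quad E_{7,r}=\begin{pmatrix}0&0&0&1\\ 0&0&0&0\end{pmatrix}.\]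
   Context: A 2-dimensional real algebra is a 2-dimensional real vector space with a bilinear multiplication (not necessarily associative or unital); it is non-trivial if the multiplication is not identically zero. It is an evolution algebra if it admits a basis $\{e_1,e_2\}$ such that $e_ie_j=0$ whenever $i\ne j$. Given a basis $(e_1,e_2)$, the matrix of structure constants (MSC) of an algebra is \[A=\begin{pmatrix}A^1_{1,1}&A^1_{1,2}&A^1_{2,1}&A^1_{2,2}\\ A^2_{1,1}&A^2_{1,2}&A^2_{2,1}&A^2_{2,2}\end{pmatrix},\qquad e_i\cdot e_j=A^1_{i,j}e_1+A^2_{i,j}e_2.\] Two algebras with MSCs $A$ and $B$ are isomorphic (written $A\simeq B$) if and only if $B=gA(g^{-1}\otimes g^{-1})$ for some $g\in GL(2,\mathbb{R})$, where $\otimes$ is the Kronecker product. An algebra is identified with its MSC. *)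

(* Defs.v *)
From HB Require Import structures.
From mathcomp Require Import all_boot all_order all_algebra.
From mathcomp Require Import reals mxtens.

Set Implicit Arguments.
Unset Strict Implicit.
Unset Printing Implicit Defensive.

Import GRing.Theory.
Local Open Scope ring_scope.

Definition nontrivial_algebra (R : realType) (V : vectType R)
    (mul : {bilinear V -> V -> V}) : Prop :=
  exists x y : V, mul x y != 0.

Definition evolution_algebra (R : realType) (V : vectType R)
    (mul : {bilinear V -> V -> V}) : Prop :=
  exists e : 2.-tuple V, basis_of fullv e /\
    forall i j : 'I_2, i != j -> mul (tnth e i) (tnth e j) = 0.

(* [mxtens_index (i, j)] is [i * 2 + j], so the columns of a matrix of structure
   constants are ordered (1,1), (1,2), (2,1), (2,2), in agreement with the
   Kronecker product [*t]. *)
Definition is_msc (R : realType) (V : vectType R)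
    (mul : {bilinear V -> V -> V}) (e : 2.-tuple V)
    (A : 'M[R]_(2, 2 * 2)) : Prop :=
  forall i j : 'I_2,
    mul (tnth e i) (tnth e j) = \sum_(k < 2) A k (mxtens_index (i, j)) *: tnth e k.

Definition msc_iso (R : realType) (A B : 'M[R]_(2, 2 * 2)) : Prop :=
  exists2 g : 'M[R]_2, g \in unitmx & B = g *m A *m (invmx g *t invmx g).

(* The algebra on column vectors whose MSC in the canonical basis is [A]. *)
Definition msc_mul (R : realType) (A : 'M[R]_(2, 2 * 2)) (x y : 'cV[R]_2) :
  'cV[R]_2 := A *m (x *t y).

Lemma msc_mul_bilinear (R : realType) (A : 'M[R]_(2, 2 * 2)) :
  bilinear_for *:%R *:%R (msc_mul A).
Proof.
split=> u a x y; rewrite /msc_mul -linearP; congr (A *m _);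
  by apply/matrixP=> i j; rewrite !mxE ?mulrDl ?mulrDr ?mulrA // (mulrC a).
Qed.

HB.instance Definition _ (R : realType) (A : 'M[R]_(2, 2 * 2)) :=
  bilinear_isBilinear.Build R 'cV[R]_2 'cV[R]_2 'cV[R]_2 *:%R *:%R
    (msc_mul A) (msc_mul_bilinear A).

Lemma msc_mul_is_msc (R : realType) (A : 'M[R]_(2, 2 * 2)) :
  is_msc (msc_mul A) [tuple delta_mx i 0 | i < 2] A.
Proof.
have ord1T (a : 'I_1) : (a == 0) = true by rewrite ord1 eqxx.
move=> i j; rewrite !tnth_mktuple; apply/colP=> k.
rewrite summxE (bigD1 k) //= big1 => [|l /negPf nlk]; last first.
  by rewrite tnth_mktuple !mxE eq_sym nlk mulr0.
rewrite tnth_mktuple !mxE !eqxx mulr1 addr0.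
rewrite (bigD1 (mxtens_index (i, j))) //= big1 => [|p npij].
  by rewrite !mxE !mxtens_indexK /= !eqxx !ord1T !mulr1 addr0.
rewrite !mxE !ord1T !andbT; have [pi|_] := eqP; last by rewrite mul0r mulr0.
have [pj|_] := eqP; last by rewrite !mulr0.
by rewrite -(mxtens_unindexK p) -pi -pj -surjective_pairing eqxx in npij.
Qed.

Definition mx_of_rows (R : realType) (r1 r2 : seq R) : 'M[R]_(2, 2 * 2) :=
  \matrix_(k, p) nth 0 (nth [::] [:: r1; r2] k) p.

Inductive member (R : realType) : Type :=
  | E1 of R & R | E2 of R | E3 | E4 | E5 | E6 | E7.

Arguments E3 {R}.
Arguments E4 {R}.
Arguments E5 {R}.
Arguments E6 {R}.
Arguments E7 {R}.

Definition admissible (R : realType) (m : member R) : Prop :=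
  if m is E1 b c then b * c <> 1 else True.

Definition same_member (R : realType) (m m' : member R) : Prop :=
  m = m' \/ exists b c : R, m = E1 b c /\ m' = E1 c b.

Definition msc_of (R : realType) (m : member R) : 'M[R]_(2, 2 * 2) :=
  match m with
  | E1 b c => mx_of_rows [:: 1; 0; 0; b]
                         [:: c; 0; 0; 1]
  | E2 b   => mx_of_rows [:: 1; 0; 0; b]
                         [:: 1; 0; 0; 0]
  | E3     => mx_of_rows [:: 0; 0; 0; 1]
                         [:: 1; 0; 0; 0]
  | E4     => mx_of_rows [:: 1; 0; 0; 1]
                         [:: 0; 0; 0; 0]
  | E5     => mx_of_rows [:: 1; 0; 0; -1]
                         [:: 0; 0; 0; 0]
  | E6     => mx_of_rows [:: 1; 0; 0; -1]
                         [:: -1; 0; 0; 1]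
  | E7     => mx_of_rows [:: 0; 0; 0; 1]
                         [:: 0; 0; 0; 0]
  end.

(* Main.v *)
(** Write a natural basis product as [e1 e1 = a e1 + c e2], [e2 e2 = b e1 + d e2].
    If [a d - b c <> 0], every isomorphism is monomial in the natural bases, so
    the class is found by rescaling (with a cube root when [a = d = 0]) and
    swapping the basis vectors.  Otherwise the product has the form
    [x y = B(x, y) v] for a diagonal form [B] and a vector [v], and the classes
    E2(0), E4, E5, E6, E7 are told apart by the rank and signature of [B] and by
    whether [B(v, v)] vanishes. *)

Require Import Defs.
From mathcomp Require Import all_boot all_order all_algebra.
From mathcomp Require Import reals mxtens ring lra.

Set Implicit Arguments.
Unset Strict Implicit.
Unset Printing Implicit Defensive.

Import Order.TTheory GRing.Theory Num.Theory.
Local Open Scope ring_scope.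

(** * Isomorphism of structure matrices and change of basis *)

Lemma tens1mx1 (R : comPzRingType) m n :
  (1%:M : 'M[R]_m) *t (1%:M : 'M[R]_n) = 1%:M.
Proof.
apply/matrixP=> i j.
case: (mxtens_indexP i)=> i0 i1; case: (mxtens_indexP j)=> j0 j1.
by rewrite tensmxE !mxE (can_eq (@mxtens_indexK m n)) xpair_eqE -natrM mulnb.
Qed.

(** Clearing the inverses of [g] leaves equations that are polynomial in its entries. *)
Lemma msc_isoP (R : realType) (A B : 'M[R]_(2, 2 * 2)) :
  msc_iso A B <->
  exists2 g : 'M[R]_2, g \in unitmx & B *m (g *t g) = g *m A.
Proof.
split=> -[g gU].
  move=> ->; exists g => //.
  by rewrite -mulmxA tensmx_mul mulVmx // tens1mx1 mulmx1.
move=> BA; exists g => //.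
by rewrite -BA -mulmxA tensmx_mul mulmxV // tens1mx1 mulmx1.
Qed.

Lemma msc_iso_sym (R : realType) (A B : 'M[R]_(2, 2 * 2)) :
  msc_iso A B -> msc_iso B A.
Proof.
case=> g gU ->; apply/msc_isoP; exists (invmx g); first by rewrite unitmx_inv.
by rewrite -mulmxA mulKmx.
Qed.

Lemma msc_iso_trans (R : realType) (A B C : 'M[R]_(2, 2 * 2)) :
  msc_iso A B -> msc_iso B C -> msc_iso A C.
Proof.
move=> /msc_isoP[g gU AB] /msc_isoP[h hU BC]; apply/msc_isoP.
exists (h *m g); first by rewrite unitmx_mul hU.
by rewrite -tensmx_mul mulmxA BC -!mulmxA AB.
Qed.

Lemma sum_mxtens_index (V : nmodType) m n (F : 'I_(m * n) -> V) :
  \sum_k F k = \sum_(i < m) \sum_(j < n) F (mxtens_index (i, j)).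
Proof.
rewrite pair_big /= (reindex (@mxtens_index m n)) /=; last first.
  by exists (@mxtens_unindex m n) => k _; rewrite (mxtens_indexK, mxtens_unindexK).
by apply: eq_bigr => -[].
Qed.

(** Take for [g] the matrix whose columns are the [f]-coordinates of the vectors of [e]. Both sides
    of [B *m (g *t g) = g *m A] then list the [f]-coordinates of the products of vectors of [e]. *)
Lemma msc_iso_change_basis (R : realType) (V : vectType R)
    (mul : {bilinear V -> V -> V}) (e f : 2.-tuple V) (A B : 'M[R]_(2, 2 * 2)) :
  basis_of fullv e -> basis_of fullv f ->
  is_msc mul e A -> is_msc mul f B -> msc_iso A B.
Proof.
move=> be bf mA mB; apply/msc_isoP.
pose P (e f : 2.-tuple V) : 'M[R]_2 := \matrix_(k, i) coord f k (tnth e i).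
have decomp (e' f' : 2.-tuple V) i : basis_of fullv f' ->
    tnth e' i = \sum_k P e' f' k i *: tnth f' k.
  move=> bf'; rewrite [LHS](coord_basis bf' (memvf _)).
  by apply: eq_bigr => k _; rewrite mxE -tnth_nth.
have coordf (a : 'I_2 -> R) k : coord f k (\sum_i a i *: tnth f i) = a k.
  have := coord_sum_free a k (basis_free bf).
  by under eq_bigr do rewrite -tnth_nth.
exists (P e f).
  suff PQ : P e f *m P f e = 1%:M by case: (mulmx1_unit PQ).
  apply/matrixP=> i j; rewrite mxE.
  transitivity (coord f i (tnth f j)); last first.
    by rewrite (tnth_nth 0) coord_free ?(basis_free bf) // mxE eq_sym.
  rewrite (decomp f e j be) linear_sum; apply: eq_bigr => k _.
  by rewrite linearZ /= mulrC [P e f i k]mxE.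
apply/matrixP=> k p; case: (mxtens_indexP p) => i j.
transitivity (coord f k (mul (tnth e i) (tnth e j))); last first.
  rewrite mA linear_sum mxE; apply: eq_bigr => h _.
  by rewrite linearZ /= mulrC [P e f k h]mxE.
rewrite [in RHS](decomp e f i bf) [in RHS](decomp e f j bf) mxE sum_mxtens_index.
rewrite linear_sumlz linear_sum; apply: eq_bigr => l _.
rewrite linear_sumr linear_sum; apply: eq_bigr => m _.
by rewrite linearZl_LR linearZr_LR !linearZ /= mB coordf tensmxE; ring.
Qed.

(** * Structure matrices in natural bases *)

Definition evo_msc (R : realType) (a b c d : R) : 'M[R]_(2, 2 * 2) :=
  mx_of_rows [:: a; 0; 0; b] [:: c; 0; 0; d].

Lemma ord2P (P : 'I_2 -> Prop) : P 0 -> P 1 -> forall i, P i.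
Proof.
by move=> P0 P1 [[|[|//]] lti]; [move: P0|move: P1]; congr P; apply/val_inj.
Qed.

Lemma sum_ord2 (V : nmodType) (F : 'I_2 -> V) : \sum_i F i = F 0 + F 1.
Proof.
by rewrite !big_ord_recl big_ord0 addr0; congr (F _ + F _); apply/val_inj.
Qed.

Lemma det2 (R : comPzRingType) (M : 'M[R]_2) : \det M = M 0 0 * M 1 1 - M 0 1 * M 1 0.
Proof.
rewrite (expand_det_row _ 0) sum_ord2 /cofactor !det_mx11 !mxE /=.
rewrite add0n expr0 expr1 mul1r mulN1r mulrN.
by congr (M _ _ * M _ _ - M _ _ * M _ _); apply/val_inj.
Qed.

Lemma evo_mscE (R : realType) (a b c d : R) (k i j : 'I_2) :
  evo_msc a b c d k (mxtens_index (i, j)) =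
  if i == j then if i == 0 then if k == 0 then a else c
                 else if k == 0 then b else d
  else 0.
Proof.
by rewrite mxE; move: k i j; do 3![apply: ord2P].
Qed.

Lemma evo_mul_tens (R : realType) (a b c d : R) (g : 'M[R]_2) (k i j : 'I_2) :
  (evo_msc a b c d *m (g *t g)) k (mxtens_index (i, j)) =
  (if k == 0 then a else c) * (g 0 i * g 0 j) +
  (if k == 0 then b else d) * (g 1 i * g 1 j).
Proof.
by rewrite mxE sum_mxtens_index !sum_ord2 !tensmxE !evo_mscE /= !mul0r add0r addr0.
Qed.

Lemma mul_evo (R : realType) (a b c d : R) (g : 'M[R]_2) (k i j : 'I_2) :
  (g *m evo_msc a b c d) k (mxtens_index (i, j)) =
  if i == j then if i == 0 then g k 0 * a + g k 1 * c
                 else g k 0 * b + g k 1 * d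
  else 0.
Proof.
rewrite mxE !sum_ord2 !evo_mscE /=.
by case: eqP => _; [case: eqP | rewrite !mulr0 addr0].
Qed.

(** The vectors [(p, r)] and [(q, s)] are the images of [e1] and [e2]. The first four equations
    compare their squares, the last two say that their product vanishes; the (2,1) column repeats
    the (1,2) column by commutativity. *)
Lemma evo_isoP (R : realType) (a b c d a' b' c' d' : R) :
  msc_iso (evo_msc a b c d) (evo_msc a' b' c' d') <->
  exists p q r s, [/\ p * s - q * r != 0,
    [/\ a' * p ^+ 2 + b' * r ^+ 2 = p * a + q * c,
        c' * p ^+ 2 + d' * r ^+ 2 = r * a + s * c,
        a' * q ^+ 2 + b' * s ^+ 2 = p * b + q * d &
        c' * q ^+ 2 + d' * s ^+ 2 = r * b + s * d],
    a' * (p * q) + b' * (r * s) = 0 & c' * (p * q) + d' * (r * s) = 0].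
Proof.
split=> [/msc_isoP[g gU gP]|[p [q [r [s [det_neq0 [e1 e2 e3 e4] e5 e6]]]]]].
  exists (g 0 0), (g 0 1), (g 1 0), (g 1 1).
  have E k i j : (evo_msc a' b' c' d' *m (g *t g)) k (mxtens_index (i, j)) =
    (g *m evo_msc a b c d) k (mxtens_index (i, j)) by rewrite gP.
  move: gU; rewrite unitmxE det2 unitfE => gU.
  split=> //; [split; [move: (E 0 0 0) | move: (E 1 0 0) | move: (E 0 1 1)
    | move: (E 1 1 1)] | move: (E 0 0 1) | move: (E 1 0 1)];
    by rewrite evo_mul_tens mul_evo.
apply/msc_isoP.
pose g : 'M[R]_2 := \matrix_(i, j)
  if i == 0 then if j == 0 then p else q else if j == 0 then r else s.
exists g; first by rewrite unitmxE det2 unitfE !mxE.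
apply/matrixP=> k l; case: (mxtens_indexP l) => i j.
rewrite evo_mul_tens mul_evo !mxE /=; move: k i j.
by do 3![apply: ord2P]; rewrite /= -?expr2 // (mulrC q) (mulrC s).
Qed.

Lemma member_evo_msc (R : realType) (m : member R) :
  exists a b c d, msc_of m = evo_msc a b c d.
Proof. by case: m => *; do 4!eexists; reflexivity. Qed.

Lemma evo_msc_evolution (R : realType) (a b c d : R) :
  evolution_algebra (msc_mul (evo_msc a b c d)).
Proof.
exists [tuple delta_mx i 0 | i < 2]; split.
  rewrite basisEdim size_tuple dimvf /dim /= muln1 leqnn andbT.
  apply/subvP=> v _; rewrite (matrix_sum_delta v).
  apply: memv_suml => i _; rewrite big_ord1; apply/memvZ/memv_span.
  rewrite -[delta_mx i 0](tnth_mktuple (fun i => delta_mx i 0)).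
  exact: mem_tnth.
move=> i j ij; rewrite msc_mul_is_msc big1 // => k _.
by rewrite evo_mscE (negPf ij) scale0r.
Qed.

Lemma msc_mul_nontrivial (R : realType) (A : 'M[R]_(2, 2 * 2)) k i j :
  A k (mxtens_index (i, j)) != 0 -> nontrivial_algebra (msc_mul A).
Proof.
move=> Akij; exists (delta_mx i 0), (delta_mx j 0); apply: contra_neq Akij.
have := msc_mul_is_msc A i j; rewrite !tnth_mktuple => -> /colP/(_ k).
rewrite summxE !mxE (bigD1 k) //= big1 => [|l /negPf lk].
  by rewrite tnth_mktuple !mxE !eqxx mulr1 addr0.
by rewrite tnth_mktuple !mxE eq_sym lk mulr0.
Qed.

Lemma member_evolution_nontrivial (R : realType) (m : member R) :
  evolution_algebra (msc_mul (msc_of m)) /\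
  nontrivial_algebra (msc_mul (msc_of m)).
Proof.
have [a [b [c [d mE]]]] := member_evo_msc m; split; first by rewrite mE; exact: evo_msc_evolution.
(* Row [k] and column [(i, i)] locate an entry equal to 1. *)
pose k : 'I_2 := if m is E3 then 1 else 0.
pose i : 'I_2 := if m is E7 then 1 else 0.
apply: (@msc_mul_nontrivial _ _ k i i); rewrite /k /i.
by case: {mE k i} m => *; rewrite mxE /= oner_eq0.
Qed.

Lemma evo_mscP (R : realType) (V : vectType R) (mul : {bilinear V -> V -> V}) :
  nontrivial_algebra mul -> evolution_algebra mul ->
  exists a b c d (f : 2.-tuple V), [/\ basis_of fullv f,
    is_msc mul f (evo_msc a b c d) & [|| a != 0, b != 0, c != 0 | d != 0]].
Proof.
move=> [x [y xy]] [f [bf f0]].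
pose A k i := coord f k (mul (tnth f i) (tnth f i)).
have mA : is_msc mul f (evo_msc (A 0 0) (A 0 1) (A 1 0) (A 1 1)).
  move=> i j; under eq_bigr do rewrite evo_mscE.
  have [<-|ij] := eqVneq i j; last first.
    by rewrite f0 // big1 // => k _; rewrite scale0r.
  rewrite [LHS](coord_basis bf (memvf _)); apply: eq_bigr => k _.
  rewrite -tnth_nth -/(A k i); congr (_ *: _).
  by move: k i; do 2![apply: ord2P].
exists (A 0 0), (A 0 1), (A 1 0), (A 1 1), f; split=> //.
apply: contra_neqT xy; rewrite !negb_or !negbK => /and4P[/eqP a0 /eqP b0 /eqP c0 /eqP d0].
rewrite (coord_basis bf (memvf x)) (coord_basis bf (memvf y)).
rewrite linear_sumlz big1 // => i _; rewrite linear_sumr big1 // => j _.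
rewrite linearZl_LR linearZr_LR -!tnth_nth mA big1 ?scaler0 // => k _.
by rewrite evo_mscE a0 b0 c0 d0 !if_same scale0r.
Qed.

Lemma evo_swap (R : realType) (a b c d : R) :
  msc_iso (evo_msc a b c d) (evo_msc d c b a).
Proof.
apply/evo_isoP; exists 0, 1, 1, 0; split; [|split; ring|ring|ring].
by rewrite mul0r sub0r mul1r oppr_eq0 oner_eq0.
Qed.

(** * Existence of a listed representative *)

Lemma cube_root_ex (R : rcfType) (x : R) : exists y, y ^+ 3 = x.
Proof.
pose t := 1 + `|x|.
have t1 : 1 <= t by rewrite lerDl normr_ge0.
have xt : `|x| <= t ^+ 3.
  have -> : t ^+ 3 = `|x| + (1 + `|x| * (2 + 3 * `|x| + `|x| ^+ 2)) by rewrite /t; ring.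
  by rewrite lerDl !(addr_ge0, mulr_ge0, exprn_ge0).
have tt : - t <= t by lra.
have [|y _] := @poly_ivt R ('X^3 - x%:P) _ _ tt.
  rewrite !hornerE; move: xt; rewrite ler_norml => /andP[? ?].
  by apply/andP; split; lra.
by rewrite rootE !hornerE subr_eq0 => /eqP; exists y.
Qed.

(** A diagonal [g] with entries [p], [s] turns [a, b, c, d] into [a / p], [p b / s^2], [s c / p^2],
    [d / s]. The scalings are chosen to make 1 of [a] and [d], of [a] and [c], or of [b] and [c],
    according to which of [a], [d] vanish; a swap disposes of [a = 0], [d != 0]. *)
Lemma evo_perfect_member (R : realType) (a b c d : R) : a * d - b * c != 0 ->
  exists m : member R, admissible m /\ msc_iso (evo_msc a b c d) (msc_of m).
Proof.
wlog ad : a b c d / a = 0 -> d = 0.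
  move=> W; have [a0|a0] := eqVneq a 0; last by apply: W => /eqP; rewrite (negPf a0).
  move=> D; have [||m [mok mE]] := W d c b a; [by []|by rewrite mulrC (mulrC c)|].
  by exists m; split=> //; apply: msc_iso_trans mE; apply: evo_swap.
have [a0|a0] := eqVneq a 0.
  rewrite a0 (ad a0) mul0r sub0r oppr_eq0 mulf_eq0 negb_or => /andP[b0 c0].
  (* Reaching [E3] requires [p^2 = s c] and [s^2 = p b]; eliminating [s] gives [p^3 = b c^2]. *)
  have [p pE] := cube_root_ex (b * c ^+ 2).
  have p0 : p != 0 by apply/eqP=> p0; move: pE; rewrite p0 expr0n /= => /esym/eqP;
    rewrite mulf_eq0 expf_eq0 (negPf b0) (negPf c0).
  exists E3; split=> //; apply/evo_isoP; exists p, 0, 0, (p ^+ 2 / c).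
  split; [|split|..]; try by field.
    by rewrite mulr0 subr0 !(mulf_neq0, expf_neq0, invr_neq0).
  have -> : b = p ^+ 3 / c ^+ 2 by rewrite pE; field.
  by field.
have [d0|d0] := eqVneq d 0.
  rewrite d0 mulr0 sub0r oppr_eq0 mulf_eq0 negb_or => /andP[b0 c0].
  exists (E2 (b * c ^+ 2 / a ^+ 3)); split=> //; apply/evo_isoP.
  exists a, 0, 0, (a ^+ 2 / c); split; [|split|..]; try by field; rewrite ?a0 ?c0.
  by rewrite mulr0 subr0 !(mulf_neq0, expf_neq0, invr_neq0).
move=> D; exists (E1 (a * b / d ^+ 2) (c * d / a ^+ 2)); split=> /=.
  have -> : a * b / d ^+ 2 * (c * d / a ^+ 2) = (b * c) / (a * d).
    by field; rewrite a0 d0.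
  move=> H; move/negP: D; apply; rewrite subr_eq0 eq_sym.
  by rewrite -[b * c](divfK (mulf_neq0 a0 d0)) H mul1r.
apply/evo_isoP; exists a, 0, 0, d; split; [|split|..]; try by field; rewrite ?a0 ?d0.
by rewrite mulr0 subr0 mulf_neq0.
Qed.

(** Here [v = (a, c)], [B = diag(1, t)] and [B(v, v) = a^2 + t c^2]. If [t = 0], then [e2] spans the
    radical of [B], and the class is E7 or E2(0) according to whether [v] lies in it. If [t != 0], a
    null [v] gives E6, and otherwise the sign of [t] decides between E4 and E5. *)
Lemma evo_degenerate_member (R : realType) (a c t : R) : (a != 0) || (c != 0) ->
  exists m : member R, admissible m /\ msc_iso (evo_msc a (t * a) c (t * c)) (msc_of m).
Proof.
have [->|t0 ac] := eqVneq t 0.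
  rewrite !mul0r; have [->|a0 _] := eqVneq a 0.
    move=> /= c0; exists E7; split=> //; apply/evo_isoP.
    exists 0, c^-1, 1, 0; split; [|split|..]; try by field.
    by rewrite mulr0 sub0r mulr1 oppr_eq0 invr_eq0.
  (* The lower left entry is chosen so that [v] is sent to [a^2 (e1 + e2)]. *)
  exists (E2 0); split=> //; apply/evo_isoP; exists a, 0, ((a ^+ 2 - c) / a), 1.
  by split; [|split|..]; try field; rewrite // mulr1 mul0r subr0.
have [N0|N0] := eqVneq (a ^+ 2 + t * c ^+ 2) 0.
  exists E6; split=> //; apply/evo_isoP.
  have c0 : c != 0.
    apply: contraTneq ac => c0; move: N0; rewrite c0 expr0n mulr0 addr0.
    by move/eqP; rewrite sqrf_eq0 => /eqP->; rewrite eqxx.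
  have a0 : a != 0.
    apply: contraTneq c0 => a0; move: N0; rewrite a0 expr0n add0r.
    by move/eqP; rewrite mulf_eq0 sqrf_eq0 (negPf t0) negbK.
  have tE : t = - (a / c) ^+ 2.
    by apply: (mulIf (expf_neq0 2 c0)); rewrite -[LHS](addKr (a ^+ 2)) N0; field.
  (* [B] and [v] are matched in null coordinates of [B]: [v] is a null vector. *)
  rewrite tE; exists ((a + 1) / 2), (a / c * (1 - a) / 2), ((a - 1) / 2),
    (- (a / c) * (a + 1) / 2).
  split; [|split|..]; try by field.
  have -> : (a + 1) / 2 * (- (a / c) * (a + 1) / 2) - a / c * (1 - a) / 2 * ((a - 1) / 2)
     = - (a / c * a) by field.
  by rewrite oppr_eq0 !mulf_eq0 invr_eq0 !negb_or a0 c0.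
(* With [e] the sign of [t] and [w] the square root of its absolute value, E4 and E5 are treated at
   once. *)
have [e [w [w0 tE mE]]] : exists e w : R, [/\ w != 0, t = e * w ^+ 2 &
    exists m : member R, admissible m /\ msc_of m = evo_msc 1 e 0 0].
  case: (ltP 0 t) => tp.
    exists 1, (Num.sqrt t); split; first by rewrite gt_eqF // sqrtr_gt0.
      by rewrite mul1r sqr_sqrtr // ltW.
    by exists E4.
  have tn : 0 < - t by rewrite oppr_gt0 lt_neqAle t0.
  exists (- 1), (Num.sqrt (- t)); split; first by rewrite gt_eqF // sqrtr_gt0.
    by rewrite mulN1r sqr_sqrtr ?opprK // ltW.
  by exists E5.
case: mE => m [mok mE]; exists m; split=> //; rewrite mE; apply/evo_isoP.
(* [g] takes coordinates along [v / B(v, v)] and its [B]-orthogonal. *)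
exists a, (t * c), (- (c * w)), (a * w); rewrite tE in N0 *.
split; [|split|..]; try by ring.
by rewrite (_ : _ - _ = (a ^+ 2 + e * w ^+ 2 * c ^+ 2) * w) ?mulf_neq0 //; ring.
Qed.

Lemma evo_member_ex (R : realType) (a b c d : R) :
  [|| a != 0, b != 0, c != 0 | d != 0] ->
  exists m : member R, admissible m /\ msc_iso (evo_msc a b c d) (msc_of m).
Proof.
wlog ac : a b c d / (a != 0) || (c != 0).
  (* Once the square of [e1] is nonzero, a vanishing determinant makes the square of [e2] a multiple
     of it. *)
  move=> W neq0; have [ac|] := boolP ((a != 0) || (c != 0)); first exact: W.
  rewrite negb_or !negbK => /andP[/eqP a0 /eqP c0].
  have {}neq0 : (d != 0) || (b != 0) by move: neq0; rewrite a0 c0 eqxx /= orbC.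
  have [||m [mok mE]] := W d c b a; [by []|by case/orP: neq0 => ->; rewrite ?orbT|].
  by exists m; split=> //; apply: msc_iso_trans mE; apply: evo_swap.
move=> _; have [D|] := eqVneq (a * d - b * c) 0; last exact: evo_perfect_member.
have {}D : a * d = b * c by lra.
suff [t [-> ->]] : exists t, b = t * a /\ d = t * c by exact: evo_degenerate_member.
have [a0|a0] := eqVneq a 0; last first.
  by exists (b / a); split; [rewrite divfK | rewrite mulrAC -D mulrC mulKf].
move: ac D; rewrite a0 eqxx mul0r /= => c0 /esym/eqP; rewrite mulf_eq0 (negPf c0) orbF.
by move=> /eqP->; exists (d / c); rewrite mulr0 divfK.
Qed.

(** * Uniqueness of the representative *)

Lemma evo_iso_perfect (R : realType) (a b c d a' b' c' d' : R) :
  a' * d' - b' * c' != 0 ->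
  msc_iso (evo_msc a b c d) (evo_msc a' b' c' d') ->
  exists p s, [/\ p != 0, s != 0 &
    [/\ a' * p = a, c' * p ^+ 2 = s * c, b' * s ^+ 2 = p * b & d' * s = d] \/
    [/\ a' * p = d, c' * p ^+ 2 = s * b, b' * s ^+ 2 = p * c & d' * s = a]].
Proof.
move=> D /evo_isoP[p [q [r [s [det0 [e1 e2 e3 e4] e5 e6]]]]].
(* The equations [e5], [e6] form a linear system in [p * q] and [r * s] whose determinant is nonzero
   by [D], so [g] is diagonal or antidiagonal. *)
have pq : p * q = 0.
  apply: (mulfI D); rewrite mulr0.
  have -> : (a' * d' - b' * c') * (p * q) = d' * (a' * (p * q) + b' * (r * s))
     - b' * (c' * (p * q) + d' * (r * s)) by ring.
  by rewrite e5 e6; ring.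
have rs : r * s = 0.
  apply: (mulfI D); rewrite mulr0.
  have -> : (a' * d' - b' * c') * (r * s) = a' * (c' * (p * q) + d' * (r * s))
     - c' * (a' * (p * q) + b' * (r * s)) by ring.
  by rewrite e5 e6; ring.
have [p0|p0] := eqVneq p 0.
  move: det0; rewrite p0 mul0r sub0r oppr_eq0 mulf_eq0 negb_or => /andP[q0 r0].
  have s0 : s = 0 by apply: (mulfI r0); rewrite rs mulr0.
  rewrite p0 s0 in e1 e2 e3 e4; exists q, r; split=> //; right.
  split; [apply: (mulIf q0)|..|apply: (mulIf r0)]; lra.
have q0 : q = 0 by apply: (mulfI p0); rewrite pq mulr0.
move: det0; rewrite q0 mul0r subr0 mulf_eq0 negb_or => /andP[_ s0].
have r0 : r = 0 by apply: (mulIf s0); rewrite rs mul0r.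
rewrite q0 r0 in e1 e2 e3 e4; exists p, s; split=> //; left.
split; [apply: (mulIf p0)|..|apply: (mulIf s0)]; lra.
Qed.

(** On admissible members this decides [a d - b c != 0]; for [E1] it is admissibility that gives
    it. *)
Definition perfect (R : realType) (m : member R) : bool :=
  match m with E1 _ _ | E3 => true | E2 b => b != 0 | _ => false end.

(** The entries normalised to 0 or 1 determine the scalings [p], [s] or contradict their being
    nonzero. For two members [E1], or two members [E2], both scalings are 1, so parameters can
    differ only by the swap in [E1]. *)
Lemma perfect_unique (R : realType) (m m' : member R) :
  admissible m -> admissible m' -> perfect m' ->
  msc_iso (msc_of m) (msc_of m') -> same_member m m'.
Proof.
have E1_sym b c b' c' : b = b' /\ c = c' \/ b = c' /\ c = b' ->
    same_member (E1 b c) (E1 b' c' : member R).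
  by case=> -[-> ->]; [left | right; exists c', b'].
case: m' => [b' c'|b'||||//|//] //= mok mok' pm'.
all: case: m mok => [b c|b|||||] /= mok /evo_iso_perfect[|p [s [p0 s0 H]]].
all: try by rewrite subr_eq0 mulr1 eq_sym; apply/eqP.
all: try by rewrite mulr0 mulr1 sub0r oppr_eq0 ?oner_eq0.
all: try by case: H => -[h1 h2 h3 h4];
  first [ exfalso; lra | case/eqP: p0; lra | case/eqP: s0; lra
  | case/negP: p0; rewrite -sqrf_eq0; apply/eqP; lra
  | case/negP: s0; rewrite -sqrf_eq0; apply/eqP; lra ].
- have [p1 s1] : p = 1 /\ s = 1 by case: H => -[]; lra.
  by apply: E1_sym; rewrite p1 s1 in H; case: H => -[_ ? ? _]; [left | right]; lra.
(* The source is [E6], which has the shape of [E1 (-1) (-1)]; admissibility of the target excludes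
   it. *)
- have [p1 s1] : p = 1 /\ s = 1 by case: H => -[]; lra.
  rewrite p1 s1 in H; case: mok'; have [-> ->] : b' = -1 /\ c' = -1 by case: H => -[]; lra.
  by rewrite mulrNN mulr1.
- left; case: H => -[h1 h2 h3 h4]; last by case/eqP: s0; lra.
  have p1 : p = 1 by lra.
  have s1 : s = 1 by rewrite p1 in h2; lra.
  by congr E2; rewrite p1 s1 in h3; lra.
- by left.
Qed.

(* [E1] and [E3] are perfect, so their value is irrelevant; the order is chosen
   so that every non-isomorphism is refuted towards the higher rank. *)
Definition degeneracy_rank (R : realType) (m : member R) : nat :=
  match m with E4 => 4 | E5 => 3 | E6 => 2 | E7 => 1 | _ => 0 end.

Lemma sqr_add_eq0 (R : realDomainType) (x y : R) : x ^+ 2 + y ^+ 2 = 0 -> x = 0 /\ y = 0.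
Proof.
by move/eqP; rewrite paddr_eq0 ?sqr_ge0 // !sqrf_eq0 => /andP[/eqP-> /eqP->].
Qed.

(** In each case the equations force the determinant of [g] to vanish. The targets come in the order
    E4, E5, E6, E7, and for each the sources are E2(0) and then the later members of the list. *)
Lemma degenerate_not_iso (R : realType) (m m' : member R) :
  ~~ perfect m -> ~~ perfect m' -> (degeneracy_rank m < degeneracy_rank m')%N ->
  ~ msc_iso (msc_of m) (msc_of m').
Proof.
(* For the form [diag(1, -1)], a nonzero null vector is orthogonal only to its own line. *)
have null_col (p q r s : R) : q ^+ 2 = s ^+ 2 -> p * q = r * s -> p * s - q * r = 0.
  move=> qs pq; apply/eqP; rewrite -sqrf_eq0; apply/eqP.
  have -> : (p * s - q * r) ^+ 2 =
    p ^+ 2 * s ^+ 2 - 2 * (p * q) * (r * s) + q ^+ 2 * r ^+ 2 by ring.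
  have : (p * q) ^+ 2 = r ^+ 2 * q ^+ 2 by rewrite pq qs; ring.
  by rewrite -qs -pq; lra.
case: m' => [b' c'|b'|||||] //; case: m => [b c|b|||||] //=;
  rewrite ?negbK => nm _ _ /evo_isoP[p [q [r [s [/eqP+ [e1 e2 e3 e4] e5 e6]]]]]; apply.
- by have [|-> ->] := @sqr_add_eq0 _ q s; [rewrite (eqP nm) in e3; lra|ring].
(* In E5, as in E6 below, the squares of [e1] and [e2] are opposite, so [e1 + e3] equates a sum of
   four squares with 0. *)
- have [|p0 r0] := @sqr_add_eq0 _ p r.
    by have := (sqr_ge0 p, sqr_ge0 r, sqr_ge0 q, sqr_ge0 s) => -[[[]]]; lra.
  by rewrite p0 r0; ring.
- have [|p0 r0] := @sqr_add_eq0 _ p r.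
    by have := (sqr_ge0 p, sqr_ge0 r, sqr_ge0 q, sqr_ge0 s) => -[[[]]]; lra.
  by rewrite p0 r0; ring.
- by have [|-> ->] := @sqr_add_eq0 _ p r; [lra|ring].
- by rewrite (eqP nm) in e3; apply: null_col; lra.
(* From E6 to E5: the image [(p - q, r - s)] of the null vector [v = e1 - e2] is a multiple of [e1],
   and its value [(p - q)^2] under the form must be 0. *)
- have -> : s = r by lra.
  have /eqP : (p - q) ^+ 2 = 0.
    have rs : s = r by lra.
    rewrite rs in e3 e5; have -> : (p - q) ^+ 2 = p ^+ 2 + q ^+ 2 - 2 * (p * q) by ring.
    lra.
  by rewrite sqrf_eq0 => /eqP pq; rewrite -mulrBl pq mul0r.
- have r0 : r = 0 by lra.
  have /eqP : p ^+ 2 = 0 by rewrite r0 in e1; lra.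
  by rewrite sqrf_eq0 r0 => /eqP->; ring.
- by rewrite (eqP nm) in e3; apply: null_col; lra.
- have rp : r = - p by lra.
  by rewrite rp in e5 *; lra.
- have /eqP : s ^+ 2 = 0 by rewrite (eqP nm) in e3; lra.
  rewrite sqrf_eq0 => /eqP s0; have -> : r = 0 by lra.
  by rewrite s0; ring.
Qed.

Lemma members_unique (R : realType) (m m' : member R) :
  admissible m -> admissible m' ->
  msc_iso (msc_of m) (msc_of m') -> same_member m m'.
Proof.
have same_sym (m1 m2 : member R) : same_member m1 m2 -> same_member m2 m1.
  by case=> [->|[b [c [-> ->]]]]; [left | right; exists c, b].
move=> mok mok' iso.
case pm': (perfect m'); first exact: perfect_unique.
case pm: (perfect m); first exact/same_sym/perfect_unique/msc_iso_sym.
move/negbT: pm => pm; move/negbT: pm' => pm'.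
have [lt|lt|eq_rk] := ltngtP (degeneracy_rank m) (degeneracy_rank m').
- by case: (degenerate_not_iso pm pm' lt).
- by case: (degenerate_not_iso pm' pm lt); apply: msc_iso_sym.
(* The rank is injective on the imperfect members, since among the [E2 b] only [b = 0] remains. *)
left; move: pm pm' eq_rk; case: m {mok iso} => [??|b|||||] //;
  case: m' {mok'} => [??|b'|||||] //= /negbNE/eqP-> /negbNE/eqP-> //.
Qed.

Theorem theorem3p2 (R : realType) :
  (forall m : member R, admissible m ->
     evolution_algebra (msc_mul (msc_of m)) /\
     nontrivial_algebra (msc_mul (msc_of m))) /\
  (forall b c : R, b * c <> 1 ->
     msc_iso (msc_of (E1 b c)) (msc_of (E1 c b))) /\
  (forall (V : vectType R) (mul : {bilinear V -> V -> V})
     (e : 2.-tuple V) (A : 'M[R]_(2, 2 * 2)),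
     \dim (fullv : {vspace V}) = 2%N ->
     nontrivial_algebra mul -> evolution_algebra mul ->
     basis_of fullv e -> is_msc mul e A ->
     exists m : member R,
       admissible m /\ msc_iso A (msc_of m) /\
       forall m' : member R,
         admissible m' -> msc_iso A (msc_of m') -> same_member m m').
Proof.
split; first by move=> m _; exact: member_evolution_nontrivial.
split; first by move=> b c _; exact: evo_swap.
move=> V mul e A _ nt evo be mA.
(* The given basis [e] need not be natural, so [A] is first carried to a natural basis [f]. *)
have [a [b [c [d [f [bf mf neq0]]]]]] := evo_mscP nt evo.
have Af := msc_iso_change_basis be bf mA mf.
have [m [mok mE]] := evo_member_ex neq0.
have Am := msc_iso_trans Af mE.
exists m; split=> //; split=> // m' mok' Am'.
exact: members_unique mok mok' (msc_iso_trans (msc_iso_sym Am) Am').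
Qed.
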